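(* Let $n\ge 1$ and let $V\subset C(\mathbb{R}^n)$ be a finite-dimensional affine-invariant real linear subspace. Then either $V=\{0\}$, or there exists an integer $\ell\ge 0$ such that $V=\mathcal{P}_{\le \ell}(\mathbb{R}^n)$. Conversely, the zero space and each $\mathcal{P}_{\le \ell}(\mathbb{R}^n)$, $\ell\ge 0$, are finite-dimensional and affine-invariant.
   Context: $C(\mathbb{R}^n)$ is the real vector space of continuous functions $\mathbb{R}^n\to\mathbb{R}$. $\operatorname{Aff}(n)$ is the group of maps $g:\mathbb{R}^n\to\mathbb{R}^n$ of the form $g(x)=Ax+b$ with $A\in\operatorname{GL}(n,\mathbb{R})$ and $b\in\mathbb{R}^n$. A linear subspace $V\subset C(\mathbb{R}^n)$ is affine-invariant if $f\in V$ and $g\in\operatorname{Aff}(n)$ imply $f\circ g\in V$. $\mathcal{P}_{\le \ell}(\mathbb{R}^n)$ is the space of all real polynomial functions on $\mathbb{R}^n$ of total degree at most $\ell$. *)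

(* Defs.v *)
From mathcomp Require Import all_boot all_order all_algebra.
From mathcomp Require Import all_classical all_reals all_analysis.
(* The notations of mpoly clash with those of all_analysis. *)
From mathcomp Require Import -(notations) mpoly.

Set Implicit Arguments.
Unset Strict Implicit.
Unset Printing Implicit Defensive.

Import Order.TTheory GRing.Theory Num.Theory.
Import numFieldNormedType.Exports.

Local Open Scope classical_set_scope.
Local Open Scope ring_scope.

(* R^o is R as a module over itself, so that functions form an lmodType R. *)
Definition contfun (R : realType) (n : nat) : set ('cV[R]_n -> R^o) :=
  [set f | continuous f].

Definition linear_subspace (R : realType) (n : nat)
    (V : set ('cV[R]_n -> R^o)) : Prop :=
  V `<=` @contfun R n /\ GRing.submod_closed (mem V).

Definition finite_dimensional (R : realType) (n : nat)
    (V : set ('cV[R]_n -> R^o)) : Prop :=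
  exists (k : nat) (e : 'I_k -> 'cV[R]_n -> R^o),
    (forall i, V (e i)) /\
    (forall f, V f -> exists c : 'I_k -> R, f = \sum_(i < k) c i *: e i).

Definition Aff (R : realType) (n : nat) : set ('cV[R]_n -> 'cV[R]_n) :=
  [set g | exists (A : 'M[R]_n) (b : 'cV[R]_n),
     A \in unitmx /\ g = (fun x => A *m x + b)].

Definition affine_invariant (R : realType) (n : nat)
    (V : set ('cV[R]_n -> R^o)) : Prop :=
  forall f g, V f -> @Aff R n g -> V (f \o g).

(* msize p is 1 + the total degree of p, and msize 0 = 0. *)
Definition polyfun_le (R : realType) (n l : nat) : set ('cV[R]_n -> R^o) :=
  [set f | exists p : mpoly n R,
     (msize p <= l.+1)%N /\
     f = (fun x : 'cV[R]_n => meval (fun i => x i 0) p)].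

Arguments polyfun_le R n l : clear implicits.

(* Main.v *)
(* Let T h be the translation f |-> f (. + h) on V. Dilations conjugate T (a h)
   to T h for all a <> 0, so by continuity at a = 0 the characteristic
   polynomial of T h is that of the identity, and T h is unipotent by
   Cayley-Hamilton. Hence T ((a + j h) v) is polynomial in the integer j, and
   by continuity T (t v) depends polynomially on the real t. Writing T h as the
   product of the translations along the axes shows that V consists of
   polynomial functions. Diagonal matrices then split every f in V into its
   monomials, which all lie in V, and a positive affine substitution in x^a in V
   produces all the monomials of degree at most |a|. *)
Require Import Defs.
From mathcomp Require Import all_boot all_order all_algebra.
From mathcomp Require Import all_classical all_reals all_analysis.
From mathcomp Require Import -(notations) mpoly.
From mathcomp Require Import ring lra.
Import numFieldNormedType.Exports.
Import Order.TTheory GRing.Theory Num.Theory.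
Local Open Scope classical_set_scope.
Local Open Scope ring_scope.

Set Implicit Arguments.
Unset Strict Implicit.
Unset Printing Implicit Defensive.

(** * Polynomial interpolation, limits, determinants and unipotent powers *)

Lemma eq_poly_nat (R : numDomainType) (p q : {poly R}) :
  (forall k : nat, p.[k%:R] = q.[k%:R]) -> p = q.
Proof.
move=> pq; apply/eqP; rewrite -subr_eq0; apply/negPn/negP => nz.
pose rs : seq R := [seq k%:R | k <- iota 0 (size (p - q))].
have rootrs : all (root (p - q)) rs.
  by apply/allP => _ /mapP[k _ ->]; rewrite rootE hornerD hornerN pq subrr.
have uniqrs : uniq rs.
  by rewrite map_inj_uniq ?iota_uniq // => i j /eqP; rewrite eqr_nat => /eqP.
by have := max_poly_roots nz rootrs uniqrs; rewrite size_map size_iota ltnn.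
Qed.

Lemma eq_continuous_limit (R : realType) (f g : R -> R) (t : R) :
    continuous f -> continuous g ->
    (forall e, 0 < e -> exists2 x, `|t - x| < e & f x = g x) ->
  f t = g t.
Proof.
move=> cf cg fg; apply/eqP; rewrite -subr_eq0; apply/negPn/negP => nz.
have cfg : {for t, continuous (fun x => f x - g x)} by apply: cvgB; [exact: cf|exact: cg].
have /nbhs_ballP[e /= e0 be] : nbhs t [set x | f x - g x != 0].
  by have := cfg _ (open_nbhs_nbhs (conj (@open_neq R 0) nz)).
have [x tx fgx] := fg e e0.
by have := be x tx; rewrite /= fgx subrr eqxx.
Qed.

(** The polynomial found on the naturals also fits [phi] on every grid of mesh [1 / (N + 1)], since
    such a grid starting at [- s] contains the naturals. These grids come arbitrarily close to any
    real, and continuity concludes. *)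
Lemma poly_of_progressions (R : realType) (phi : R -> R) :
    continuous phi ->
    (forall a h : R, exists P : {poly R}, forall j : nat, phi (a + j%:R * h) = P.[j%:R]) ->
  exists P : {poly R}, forall t, phi t = P.[t].
Proof.
move=> cphi prog; have [P PE] := prog 0 1; exists P => t.
have grid (s N j : nat) : phi (- s%:R + j%:R * N.+1%:R^-1) = P.[- s%:R + j%:R * N.+1%:R^-1].
  have [Q QE] := prog (- s%:R) (N.+1%:R^-1).
  have N0 : N.+1%:R != 0 :> R by rewrite pnatr_eq0.
  (* The grid point of index [N.+1 * (i + s)] is the integer [i], so both sides agree at all
     naturals. *)
  have -> : P = Q \Po (N.+1%:R *: ('X + s%:R%:P)).
    apply: eq_poly_nat => i.
    rewrite horner_comp !hornerE -natrD -natrM -QE -PE; congr phi.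
    by rewrite natrM natrD; field.
  by rewrite QE horner_comp !hornerE; congr (Q.[_]); field.
apply: eq_continuous_limit => //; first exact: continuous_horner.
move=> e e0.
(* The grid starts left of [t] because [s] exceeds [|t|], and its mesh is below [e] by the choice of
   [N]; the index [j] below picks the last grid point not exceeding [t]. *)
pose s := (Num.truncn `|t|).+1; pose N := Num.truncn e^-1.
have ts : 0 <= t + s%:R.
  have := truncnS_gt `|t|; rewrite -/s => ?.
  by have := ler_norm (- t); rewrite normrN; lra.
have eN : N.+1%:R^-1 < e by rewrite invf_plt ?posrE ?ltr0n // truncnS_gt.
have N0 : 0 < N.+1%:R :> R by rewrite ltr0n.
set M : R := N.+1%:R in eN N0.
pose j := Num.truncn ((t + s%:R) * M).
exists (- s%:R + j%:R * M^-1); last exact: grid.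
have /andP[j1 j2] : (j%:R <= (t + s%:R) * M < j.+1%:R) by apply: truncn_itv; rewrite mulr_ge0 // ltW.
have tE : t - (- s%:R + j%:R / M) = ((t + s%:R) * M - j%:R) / M.
  by field; rewrite gt_eqF.
rewrite tE ger0_norm; last by rewrite divr_ge0 ?subr_ge0 // ltW.
apply: lt_trans eN; rewrite -[ltRHS]mul1r ltr_pM2r ?invr_gt0 //.
by rewrite -natr1 in j2; lra.
Qed.

Lemma continuous_det (R : realType) (T : topologicalType) (n : nat) (A : T -> 'M[R]_n) :
  (forall i j, continuous (fun x => A x i j)) -> continuous (fun x => \det (A x)).
Proof.
move=> cA; apply: continuous_big => [|s _]; first exact: add_continuous.
move=> x; apply: cvgM; first exact: cvg_cst.
by apply: cvg_big => [|i _]; [exact: mul_continuous|exact: cA].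
Qed.

Lemma bin_poly (R : numFieldType) (i : nat) :
  exists B : {poly R}, forall j : nat, B.[j%:R] = 'C(j, i)%:R.
Proof.
elim: i => [|i [B BE]]; first by exists 1 => j; rewrite hornerC bin0.
exists (i.+1%:R^-1 *: (B * ('X - i%:R%:P))) => j.
rewrite !hornerE BE; apply: (@mulfI _ i.+1%:R); first by rewrite pnatr_eq0.
rewrite !mulrA mulfV ?pnatr_eq0 // mul1r -natrM mul_bin_left natrM.
(* Truncated subtraction is the true [j - i] only for [i <= j]; otherwise ['C(j, i)] vanishes. *)
have [ij|ji] := leqP i j; first by rewrite natrB // mulrC.
by rewrite bin_small // mulr0 mul0r.
Qed.

Lemma char_poly_horner (R : comNzRingType) (n : nat) (A : 'M[R]_n) (s : R) :
  (char_poly A).[s] = \det (s%:M - A).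
Proof.
rewrite /char_poly -horner_evalE -det_map_mx; congr (\det _).
apply/matrixP => i j.
by rewrite !mxE -[LHS]/(('X *+ (i == j) - (A i j)%:P).[s]) hornerD hornerN hornerC hornerMn hornerX.
Qed.

(** The binomial expansion is cut off by nilpotency. Its range no longer involves [j], which makes
    the entries of [A ^+ j] polynomial in [j]. *)
Lemma unipotent_pow (R : numFieldType) (r j : nat) (A : 'M[R]_r.+1) :
  (A - 1) ^+ r.+1 = 0 ->
  A ^+ j = \sum_(i < r.+1) (A - 1) ^+ i *+ 'C(j, i).
Proof.
move=> nilp; rewrite -{1}(subrK 1 A); set N := A - 1 in nilp *.
rewrite addrC exprDn_comm; last exact: commr_sym (commr1 _).
under eq_bigr do rewrite expr1n mul1r.
rewrite -!(big_mkord xpredT (fun i => N ^+ i *+ 'C(j, i))).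
(* Both sums extend to a common range: ['C(j, i)] vanishes for [i > j], and [N ^+ i] for [i > r]. *)
transitivity (\sum_(0 <= i < r.+1 + j.+1) N ^+ i *+ 'C(j, i)).
  rewrite [RHS](big_cat_nat _ (n := j.+1)) //= ?leq_addl // [X in _ = _ + X]big_nat_cond.
  rewrite [X in _ = _ + X]big1 ?addr0 // => i.
  by case/andP => /andP[ji _] _; rewrite bin_small // mulr0n.
rewrite [LHS](big_cat_nat _ (n := r.+1)) //= ?leq_addr // [X in _ + X = _]big_nat_cond.
rewrite [X in _ + X = _]big1 ?addr0 // => i.
by case/andP => /andP[ri _] _; rewrite -(subnK ri) exprD nilp mulr0 mul0rn.
Qed.

(** * Linear subspaces and unisolvent bases *)

Section LinearSubspace.
Context {R : realType} {n : nat} (V : set ('cV[R]_n -> R^o)).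
Hypothesis linV : linear_subspace V.

Lemma subspace0 : V 0.
Proof. by case: linV => _ [V0 _]; move: V0; rewrite inE. Qed.

Lemma subspaceZD (a : R) f g : V f -> V g -> V (a *: f + g).
Proof.
case: linV => _ [_ VP] Vf Vg.
by have := VP a f g; rewrite !inE; apply.
Qed.

Lemma subspace_sum (I : Type) (s : seq I) (c : I -> R) (f : I -> 'cV[R]_n -> R^o) :
  (forall i, V (f i)) -> V (\sum_(i <- s) c i *: f i).
Proof.
move=> Vf; elim: s => [|i s IH]; first by rewrite big_nil; exact: subspace0.
by rewrite big_cons; exact: subspaceZD.
Qed.

(** Take [r] maximal such that [r] functions of [V] have an invertible evaluation matrix at [r]
    points. A function outside their span, minus its interpolant, would yield one more function and
    one more point. *)
Lemma unisolvent_basis : finite_dimensional V ->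
  exists (r : nat) (e : 'I_r -> 'cV[R]_n -> R^o) (x : 'I_r -> 'cV[R]_n),
    [/\ forall i, V (e i), \matrix_(i, j) e i (x j) \in unitmx &
        forall f, V f -> exists c : 'rV[R]_r, forall y, f y = \sum_i c 0 i * e i y].
Proof.
move=> [k [b [Vb span]]].
pose unisolvent r := exists (e : 'I_r -> 'cV[R]_n -> R^o) (x : 'I_r -> 'cV[R]_n),
  (forall i, V (e i)) /\ \matrix_(i, j) e i (x j) \in unitmx.
have uni0 : exists r, `[< unisolvent r >].
  exists 0%N; apply/asboolP; exists (fun=> 0), (fun=> 0); split=> [[]//|].
  by rewrite unitmxE det_mx00 unitr1.
have bounded r : `[< unisolvent r >] -> (r <= k)%N.
  move=> /asboolP[e [x [Ve]]].
  have /choice[C CE] : forall i, exists c, e i = \sum_l c l *: b l by move=> i; exact: span.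
  (* The evaluation matrix factors through dimension [k], so its rank is at most [k]. *)
  have -> : \matrix_(i, j) e i (x j) = \matrix_(i, l) C i l *m \matrix_(l, j) b l (x j).
    by apply/matrixP => i j; rewrite !mxE CE fct_sumE; apply: eq_bigr => l _; rewrite !mxE.
  move=> /mxrank_unit <-.
  exact: leq_trans (mxrankM_maxl _ _) (rank_leq_col _).
case: (ex_maxnP uni0 bounded) => r /asboolP[e [x [Ve Fu]]] rmax.
exists r, e, x; split=> // f Vf.
pose F := \matrix_(i, j) e i (x j).
(* Coefficients of the interpolant of [f] at the points [x j]. *)
pose c := \row_j f (x j) *m invmx F; exists c => y.
apply/eqP; rewrite -subr_eq0; apply/negPn/negP => nz.
pose h := f - \sum_i c 0 i *: e i.
have hE z : h z = f z - \sum_i c 0 i * e i z by rewrite /h fctE fct_sumE.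
have Vh : V h.
  rewrite /h addrC -scaleN1r; apply: subspaceZD => //; exact: subspace_sum.
have hx j : h (x j) = 0.
  have : (c *m F) 0 j = f (x j) by rewrite /c mulmxKV // mxE.
  rewrite mxE => cF; apply/eqP; rewrite hE subr_eq0 -cF; apply/eqP.
  by apply: eq_bigr => i _; rewrite [F _ _]mxE.
suff /rmax : `[< unisolvent (r + 1)%N >] by rewrite addn1 ltnn.
apply/asboolP; exists (fun i : 'I_(r + 1) => match fintype.split i with inl i => e i | inr _ => h end).
exists (fun i : 'I_(r + 1) => match fintype.split i with inl i => x i | inr _ => y end).
split=> [i|]; first by case: fintype.split.
(* As [h] vanishes at each [x j], the enlarged matrix is block triangular with determinant
   [\det F * h y]. *)
rewrite (_ : \matrix_(_, _) _ = block_mx F (\col_i e i y) 0 (h y)%:M).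
  by rewrite unitmxE det_ublock det_scalar1 unitrM -unitmxE Fu unitfE hE.
apply/matrixP => i j; rewrite !mxE.
case: splitP => i' _; rewrite !mxE; case: splitP => j' _; rewrite !mxE ?hx //.
by rewrite !ord1.
Qed.

End LinearSubspace.

(** * Closure properties of polynomial functions *)

Definition polyfun {R : realType} {n : nat} (f : 'cV[R]_n -> R) : Prop :=
  exists p : mpoly n R, f = (fun x => meval (fun i => x i 0) p).

Lemma polyfun_cst (R : realType) (n : nat) (c : R) : polyfun (fun _ : 'cV[R]_n => c).
Proof. by exists (mpolyC n c); apply/funext => x; rewrite mevalC. Qed.

Lemma polyfun_sum (R : realType) (n : nat) (I : Type) (s : seq I) (f : I -> 'cV[R]_n -> R) :
  (forall i, polyfun (f i)) -> polyfun (fun x => \sum_(i <- s) f i x).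
Proof.
move=> /choice[p pE]; exists (\sum_(i <- s) p i); apply/funext => x.
by rewrite raddf_sum; apply: eq_bigr => i _; rewrite pE.
Qed.

Lemma polyfunM (R : realType) (n : nat) (f g : 'cV[R]_n -> R) :
  polyfun f -> polyfun g -> polyfun (fun x => f x * g x).
Proof.
by move=> [p ->] [q ->]; exists (p * q); apply/funext => x; rewrite mevalM.
Qed.

Lemma polyfun_horner (R : realType) (n : nat) (P : {poly R}) (i : 'I_n) :
  polyfun (fun x : 'cV[R]_n => P.[x i 0]).
Proof.
elim/poly_ind: P => [|P c [p pE]].
  by under eq_fun do rewrite horner0; exact: polyfun_cst.
exists (p * mpolyX R (mnm1 i) + mpolyC n c); apply/funext => x.
by rewrite hornerMXaddC mevalD mevalM mevalXU mevalC (congr1 (@^~ x) pE).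
Qed.

(** * Matrices of the translations of [V] *)

Section Translations.
Context {R : realType} {n r : nat} (V : set ('cV[R]_n -> R^o)).
Hypothesis affV : affine_invariant V.
Context (e : 'I_r.+1 -> 'cV[R]_n -> R^o) (x : 'I_r.+1 -> 'cV[R]_n).
Let F := \matrix_(i, j) e i (x j).
Hypothesis (Ve : forall i, V (e i)) (Fu : F \in unitmx).
Hypothesis span : forall f, V f -> exists c : 'rV[R]_r.+1, forall y, f y = \sum_i c 0 i * e i y.

Let ev (y : 'cV[R]_n) : 'cV[R]_r.+1 := \col_i e i y.

(** The vectors [ev (x j)] are the columns of the invertible [F]. Identities between operators on
    [V] can thus be checked pointwise. *)
Lemma evaluation_faithful m (A B : 'M[R]_(m, r.+1)) :
  (forall y, A *m ev y = B *m ev y) -> A = B.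
Proof.
move=> AB; apply: (can_inj (mulmxK Fu)); apply/matrixP => i j.
have /matrixP/(_ i 0) := AB (x j); rewrite !mxE => E.
transitivity (\sum_k A i k * ev (x j) k 0); first by apply: eq_bigr => k _; rewrite !mxE.
by rewrite E; apply: eq_bigr => k _; rewrite !mxE.
Qed.

Lemma affine_matrix g : @Aff R n g -> exists A : 'M[R]_r.+1, forall y, ev (g y) = A *m ev y.
Proof.
move=> Ag.
have /choice[c cE] : forall i, exists c : 'rV[R]_r.+1, forall y, e i (g y) = \sum_k c 0 k * e k y.
  by move=> i; have [c cE] := span (affV (Ve i) Ag); exists c => y; rewrite -cE.
exists (\matrix_(i, k) c i 0 k) => y; apply/colP => i; rewrite !mxE cE.
by apply: eq_bigr => k _; rewrite !mxE.
Qed.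

(** Solving for the matrix at the points [x j] makes its entries explicit in [h], so that their
    continuity follows from that of the [e i]. *)
Let T (h : 'cV[R]_n) : 'M[R]_r.+1 := \matrix_(i, j) e i (x j + h) *m invmx F.

Lemma ev_translate h y : ev (y + h) = T h *m ev y.
Proof.
have [|A AE] := @affine_matrix (fun y => y + h).
  by exists 1%:M, h; rewrite unitmx1; split=> //; apply/funext => z; rewrite mul1mx.
suff <- : A = T h by exact: AE.
apply: (canRL (mulmxK Fu)); apply/matrixP => i j; rewrite !mxE.
have /colP/(_ i) := AE (x j); rewrite !mxE => ->.
by apply: eq_bigr => k _; rewrite !mxE.
Qed.

Lemma translate0 : T 0 = 1%:M.
Proof. by apply: evaluation_faithful => y; rewrite -ev_translate addr0 mul1mx. Qed.

Lemma translateD h k : T (h + k) = T h * T k.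
Proof.
apply: evaluation_faithful => y; rewrite -mulmxE -mulmxA -!ev_translate.
by rewrite (addrC h) addrA.
Qed.

Lemma translateMn h j : T (h *+ j) = T h ^+ j.
Proof.
elim: j => [|j IH]; first by rewrite mulr0n expr0 translate0.
by rewrite mulrS translateD IH exprS.
Qed.

(** The identity [a (y + h) = a y + a h] says that the matrix [S] of the dilation by [a] intertwines
    [T h] and [T (a *: h)]; the dilation by [a^-1] inverts [S]. *)
Lemma char_poly_translateZ (a : R) h : a != 0 -> char_poly (T (a *: h)) = char_poly (T h).
Proof.
move=> a0.
have scal (b : R) : b != 0 -> @Aff R n (fun y => b *: y).
  move=> b0; exists b%:M, 0; rewrite unitmxE det_scalar unitrX ?unitfE //; split=> //.
  by apply/funext => y; rewrite mul_scalar_mx addr0.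
have [S SE] := affine_matrix (scal a a0).
have [S' SE'] := affine_matrix (scal a^-1 (invr_neq0 a0)).
have S'S : S' *m S = 1%:M.
  apply: evaluation_faithful => y; rewrite -mulmxA -SE -SE' scalerA mulVf // scale1r mul1mx //.
have Su : S \in unitmx by have [] := mulmx1_unit S'S.
have conj : S *m T h = T (a *: h) *m S.
  by apply: evaluation_faithful => y; rewrite -[LHS]mulmxA -[RHS]mulmxA -ev_translate -!SE -ev_translate scalerDr.
apply: eq_poly_nat => s; rewrite !char_poly_horner.
have : \det (S *m (s%:R%:M - T h)) = \det ((s%:R%:M - T (a *: h)) *m S).
  by rewrite mulmxBr mulmxBl conj scalar_mxC.
rewrite !det_mulmx mulrC => /mulIf -> //.
by rewrite -unitfE -unitmxE.
Qed.

Hypothesis ce : forall i, continuous (e i).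

Lemma continuous_translate (b v : 'cV[R]_n) i j : continuous (fun a : R => T (b + a *: v) i j).
Proof.
have -> : (fun a : R => T (b + a *: v) i j) =
    (fun a : R => \sum_k e i (x k + (b + a *: v)) * invmx F k j).
  by apply/funext => a; rewrite mxE; apply: eq_bigr => k _; rewrite mxE.
apply: continuous_big => [|k _ a]; first exact: add_continuous.
apply: cvgM; last exact: cvg_cst.
apply: (@continuous_comp _ _ _ (fun a : R => x k + (b + a *: v)) (e i)); last exact: ce.
apply: cvgD; first exact: cvg_cst.
apply: cvgD; first exact: cvg_cst.
exact: scalel_continuous.
Qed.

(* The characteristic polynomial of T (a h) does not depend on a <> 0, and it
   tends to that of the identity as a -> 0. *)
Lemma translate_unipotent h : (T h - 1) ^+ r.+1 = 0.
Proof.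
have cpE : char_poly (T h) = ('X - 1) ^+ r.+1.
  apply: eq_poly_nat => s.
  have : forall a, a != 0 -> (char_poly (T (a *: h))).[s%:R] = (char_poly (T h)).[s%:R].
    by move=> a a0; rewrite char_poly_translateZ.
  pose psi (a : R) := \det (s%:R%:M - T (0 + a *: h)).
  have cpsi : continuous psi.
    apply: continuous_det => i j a.
    under eq_fun do rewrite mxE [X in _ + X]mxE.
    by apply: cvgB; [exact: cvg_cst|exact: continuous_translate].
  have psiE a : a != 0 -> psi a = (char_poly (T h)).[s%:R].
    by move=> a0; rewrite -(char_poly_translateZ h a0) char_poly_horner /psi add0r.
  rewrite -(psiE 1 (oner_neq0 _)).
  have -> : psi 1 = psi 0.
    symmetry; apply: (@eq_continuous_limit _ psi (cst (psi 1))) => //.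
      by move=> a; exact: cvg_cst.
    move=> eps eps0; exists (eps / 2); last by rewrite /= !psiE ?oner_neq0 // gt_eqF // divr_gt0.
    by rewrite sub0r normrN gtr0_norm ?divr_gt0 //; lra.
  rewrite /psi scale0r addr0 translate0 -raddfB det_scalar /=.
  by rewrite horner_exp hornerD hornerN hornerX hornerC.
have := Cayley_Hamilton (T h).
by rewrite cpE rmorphXn rmorphB /= horner_mx_X rmorph1.
Qed.

Lemma translate_line_poly v i j : exists P : {poly R}, forall t : R, T (t *: v) i j = P.[t].
Proof.
apply: poly_of_progressions => [|a h].
  have : continuous (fun a : R => T (0 + a *: v) i j) by exact: continuous_translate.
  by under eq_fun do rewrite add0r.
have [B BE] := choice (bin_poly R).
pose N := T (h *: v) - 1.
(* From [T ((a + k h) v) = T (a v) T (h v) ^+ k], with the power expanded into binomial coefficients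
   of [k], which [B] turns into polynomials. *)
exists (\sum_(k < r.+1) ((T (a *: v) * N ^+ k) i j) *: B k) => k.
rewrite scalerDl -scalerA scaler_nat translateD translateMn.
rewrite (unipotent_pow _ (translate_unipotent _)) mulr_sumr summxE horner_sum.
by apply: eq_bigr => l _; rewrite hornerZ BE mulr_natr mulrnAr mulmxnE.
Qed.

Lemma translate_polyfun i j : polyfun (fun h => T h i j).
Proof.
(* Induction over the axes: each new axis multiplies the matrix by a factor polynomial in a single
   coordinate of [h]. *)
pose part (s : seq 'I_n) (h : 'cV[R]_n) : 'cV[R]_n := \sum_(k <- s) h k 0 *: delta_mx k 0.
suff all_parts s : forall i j, polyfun (fun h => T (part s h) i j).
  have partE h : part (index_enum _) h = h.
    rewrite [RHS]matrix_sum_delta; apply: eq_bigr => k _.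
    by rewrite big_ord_recl big_ord0 addr0 ord1.
  by have := all_parts (index_enum _) i j; under eq_fun do rewrite partE.
elim: s => [|k s IH] p q.
  by under eq_fun do rewrite /part big_nil; exact: polyfun_cst.
under eq_fun do rewrite /part big_cons translateD -mulmxE mxE.
apply: polyfun_sum => l; apply: polyfunM; last exact: IH.
have [P PE] := translate_line_poly (delta_mx k 0) p l.
by under eq_fun do rewrite PE; exact: polyfun_horner.
Qed.

(** Translating the origin by [h] expresses [e i h] through the entries of [T h] and the constants
    [e k 0]. *)
Lemma basis_polyfun i : polyfun (e i).
Proof.
have -> : e i = (fun h => \sum_k T h i k * e k 0).
  apply/funext => h; have /colP/(_ i) := ev_translate h 0.
  by rewrite add0r !mxE => ->; apply: eq_bigr => k _; rewrite [ev 0 _ _]mxE.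
by apply: polyfun_sum => k; apply: polyfunM; [exact: translate_polyfun|exact: polyfun_cst].
Qed.

End Translations.

Lemma finite_dim_polyfun (R : realType) (n : nat) (V : set ('cV[R]_n -> R^o)) :
    linear_subspace V -> finite_dimensional V -> affine_invariant V ->
  exists L : nat, forall f, V f ->
    exists p : mpoly n R, (msize p <= L)%N /\ f = (fun x => meval (fun i => x i 0) p).
Proof.
move=> linV finV affV.
have [r [e [x [Ve Fu span]]]] := unisolvent_basis linV finV.
have ce i : continuous (e i) by case: linV => cV _; exact: cV.
have /choice[p pE] : forall i, polyfun (e i).
  (* The translation matrices have size [r.+1], so that they form a ring; an empty basis is settled
     apart. *)
  by case: r e x Ve Fu span ce => [|r] e x Ve Fu span ce i; [case: i|exact: (basis_polyfun affV Ve Fu span ce)].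
exists (\max_i msize (p i)) => f /span[c cE].
exists (\sum_i c 0 i *: p i); split; last first.
  by apply/funext => y; rewrite cE raddf_sum; apply: eq_bigr => i _; rewrite pE /= mevalZ.
apply: leq_trans (msize_sum _ _ _) _; apply/bigmax_leqP => i _.
by apply: leq_trans (msizeZ_le _ _) _; exact: leq_bigmax.
Qed.

(** * Isolating monomials by diagonal dilations *)

Definition monomial (R : realType) (n : nat) (m : multinom n) : 'cV[R]_n -> R^o :=
  fun x => \prod_i x i 0 ^+ m i.

Lemma meval_monomials (R : realType) (n : nat) (p : mpoly n R) :
  (fun x : 'cV[R]_n => meval (fun i => x i 0) p) =
  \sum_(m <- msupp p) mcoeff m p *: (monomial m : 'cV[R]_n -> R^o).
Proof. by apply/funext => x; rewrite mevalE fct_sumE. Qed.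

Section MonomialsOfInvariantSubspace.
Context {R : realType} {n : nat} (V : set ('cV[R]_n -> R^o)).
Hypothesis (linV : linear_subspace V) (affV : affine_invariant V).

(* If the exponents a and g differ at i, then f(D x) - 2^(g i) f(x), where D
   doubles the i-th coordinate, kills x^g and keeps a nonzero multiple of x^a. *)
Lemma monomial_extract (a : multinom n) (s : seq (multinom n)) (c : multinom n -> R) :
  c a != 0 -> a \notin s -> V (c a *: monomial a + \sum_(m <- s) c m *: monomial m) ->
  V (monomial a).
Proof.
elim: s c => [|g s IH] c ca; first rewrite big_nil => _ Vf.
  have := subspaceZD linV (c a)^-1 Vf (subspace0 linV).
  by rewrite !addr0 scalerA mulVf // scale1r.
rewrite inE negb_or => /andP[ag /IH{}IH] Vf.
have [i gai] : exists i, g i != a i.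
  apply/existsP; rewrite -negb_forall; apply: contra ag => /forallP ga.
  by apply/eqP/esym/mnmP => i; exact/eqP.
pose d : 'rV[R]_n := \row_k (if k == i then 2 else 1).
have Dinv : @Aff R n (fun x => diag_mx d *m x + 0).
  exists (diag_mx d), 0; split=> //; rewrite unitmxE det_diag unitfE.
  by apply/prodf_neq0 => k _; rewrite mxE; case: ifP; rewrite ?pnatr_eq0 ?oner_neq0.
have monoD m x : monomial m (diag_mx d *m x + 0) = 2 ^+ m i * (monomial m x : R).
  rewrite addr0 /monomial (bigD1 i) //= [in RHS](bigD1 i) //= mulrA.
  rewrite mul_diag_mx !mxE eqxx exprMn; congr (_ * _).
  by apply: eq_bigr => k /negPf ki; rewrite !mxE ki mul1r.
apply: (IH (fun m => (2 ^+ m i - 2 ^+ g i) * c m)).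
  rewrite mulf_neq0 // subr_eq0 -!natrX eqr_nat eqn_exp2l //.
  by rewrite eq_sym.
have := subspaceZD linV (- 2 ^+ g i) Vf (affV Vf Dinv).
congr (V _); apply/funext => x.
rewrite !fctE !fct_sumE !big_cons !monoD /=.
have -> : \sum_(m <- s) (c m *: monomial m) (diag_mx d *m x + 0) =
    \sum_(m <- s) 2 ^+ m i * (c m * monomial m x).
  by apply: eq_bigr => m _; rewrite fctE monoD /GRing.scale /=; ring.
have -> : \sum_(m <- s) (((2 ^+ m i - 2 ^+ g i) * c m) *: monomial m) x =
    \sum_(m <- s) 2 ^+ m i * (c m * monomial m x) - 2 ^+ g i * \sum_(m <- s) c m * monomial m x.
  by rewrite mulr_sumr -sumrB; apply: eq_bigr => m _; rewrite fctE /GRing.scale /=; ring.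
rewrite !fctE monoD /GRing.scale /=; ring.
Qed.

Lemma monomial_of_coeff (p : mpoly n R) (m : multinom n) :
  V (fun x => meval (fun i => x i 0) p) -> mcoeff m p != 0 -> V (monomial m).
Proof.
move=> Vp pm; apply: (@monomial_extract _ (rem m (msupp p)) (fun k => mcoeff k p)) => //.
  by rewrite mem_rem_uniqF ?msupp_uniq.
by rewrite meval_monomials (big_rem m) ?mcoeff_msupp // in Vp.
Qed.

End MonomialsOfInvariantSubspace.

(** * Positive coefficients and descent to lower degrees *)

(** Nonnegativity of all coefficients excludes cancellation, which makes the notion stable under
    products. *)
Definition full_support (R : realType) (n d : nat) (p : mpoly n R) : Prop :=
  forall m, 0 <= mcoeff m p /\ ((mdeg m <= d)%N -> 0 < mcoeff m p).

Lemma mnm_split (n a b : nat) (m : multinom n) : (mdeg m <= a + b)%N ->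
  exists m1 m2, [/\ m = mnm_add m1 m2, (mdeg m1 <= a)%N & (mdeg m2 <= b)%N].
Proof.
elim: b m => [|b IH] m; first rewrite addn0 => ma.
  by exists m, (@mnm0 n); rewrite addm0 mdeg0.
have [mab|mab] := leqP (mdeg m) (a + b).
  by move=> _; have [m1 [m2 [-> ? ?]]] := IH m mab; exists m1, m2; split=> //; exact: leqW.
have [i mi] : exists i, (0 < m i)%N.
  apply/existsP; rewrite -[X in is_true X]negbK negb_exists; apply/negP => /forallP m0.
  move: mab; rewrite mdegE big1 // => i _; apply/eqP; rewrite -leqn0 leqNgt; exact: m0.
(* One copy of a variable occurring in [m] is set aside for the second factor. *)
have mE : m = mnm_add (mnm_sub m (mnm1 i)) (mnm1 i).
  by rewrite submK //; apply/mnm_lepP => k; rewrite mnm1E; case: eqP => [<-|].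
rewrite {1}mE mdegD mdeg1 addn1 addnS ltnS => /IH[m1 [m2 [E m1a m2b]]].
exists m1, (mnm_add m2 (mnm1 i)); split=> //; last by rewrite mdegD mdeg1 addn1 ltnS.
by rewrite {1}mE E addmA.
Qed.

(** The coefficient of [m] is a sum of nonnegative products, and a splitting of [m] supplies a
    positive one. *)
Lemma full_supportM (R : realType) (n a b : nat) (p q : mpoly n R) :
  full_support a p -> full_support b q -> full_support (a + b) (p * q).
Proof.
move=> fp fq m; rewrite mcoeffM.
have ge0 k l : 0 <= mcoeff k p * mcoeff l q by rewrite mulr_ge0 ?(fp _).1 ?(fq _).1.
split=> [|mab]; first by apply: sumr_ge0 => k _; exact: ge0.
have [m1 [m2 [mE m1a m2b]]] := mnm_split mab.
have l1 : (mdeg m1 < (mdeg m).+1)%N by rewrite ltnS mE mdegD leq_addr.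
have l2 : (mdeg m2 < (mdeg m).+1)%N by rewrite ltnS mE mdegD leq_addl.
rewrite (bigD1 (BMultinom l1, BMultinom l2)) /=; last by rewrite mE.
apply: ltr_pwDl; first by rewrite mulr_gt0 ?(fp _).2 ?(fq _).2.
by apply: sumr_ge0 => k _; exact: ge0.
Qed.

Lemma full_support1 (R : realType) (n : nat) : full_support 0 (1 : mpoly n R).
Proof.
move=> m; rewrite mcoeff1; split=> [|]; first exact: ler0n.
by rewrite leqn0 mdeg_eq0 => ->.
Qed.

(** The variable [i] is counted once more than the others so that the linear part of these forms is
    the identity plus the all-ones matrix, which is invertible. *)
Lemma full_support_affine (R : realType) (n : nat) (i : 'I_n) :
  full_support 1 (mpolyX R (mnm1 i) + \sum_j mpolyX R (mnm1 j) + 1).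
Proof.
move=> m; rewrite !mcoeffD raddf_sum /= mcoeff1 mcoeffX.
have ge0 k : 0 <= \sum_(j : 'I_n) mcoeff k (mpolyX R (mnm1 j)).
  by apply: sumr_ge0 => j _; rewrite mcoeffX ler0n.
split=> [|]; first by rewrite !addr_ge0 ?ler0n.
rewrite leq_eqVlt ltnS leqn0 mdeg_eq0 => /orP[/mdeg1P[j /eqP ->]|/eqP ->].
  rewrite ltr_pwDl ?ler0n // ltr_wpDl ?ler0n //.
  rewrite (bigD1 j) //= mcoeffX eqxx ltr_pwDl ?ltr01 //.
  by apply: sumr_ge0 => k _; rewrite mcoeffX ler0n.
by rewrite eqxx ltr_wpDl ?ltr01 // addr_ge0 ?ler0n // ge0.
Qed.

(* Substituting affine forms with positive coefficients for the variables turns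
   x^a into a polynomial in which every monomial of degree <= |a| occurs. *)
Lemma full_support_monomial (R : realType) (n : nat) (a : multinom n) (q : 'I_n -> mpoly n R) :
  (forall i, full_support 1 (q i)) -> full_support (mdeg a) (\prod_i q i ^+ a i).
Proof.
move=> fq; have fX i k : full_support k (q i ^+ k).
  elim: k => [|k IH]; first by rewrite expr0; exact: full_support1.
  by rewrite exprS -add1n; exact: full_supportM.
rewrite mdegE; elim: (index_enum _) => [|i s IH].
  by rewrite !big_nil; exact: full_support1.
by rewrite !big_cons; exact: full_supportM.
Qed.

(** From [J *m J = n%:R *: J], the inverse of [1 + J] is [1 - J / (n + 1)]. *)
Lemma unitmx_add_const1 (R : realType) (n : nat) : 1%:M + const_mx 1 \in @unitmx R n.
Proof.
pose J : 'M[R]_n := const_mx 1.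
have sq : J *m J = n%:R *: J.
  apply/matrixP => i j; rewrite !mxE; under eq_bigr do rewrite !mxE mulr1.
  by rewrite sumr_const card_ord mulr1.
suff /mulmx1_unit[] : (1%:M + J) *m (1%:M - n.+1%:R^-1 *: J) = 1%:M by [].
rewrite mulmxDl mul1mx mulmxBr mulmx1 -scalemxAr sq; apply/matrixP => i j; rewrite !mxE.
by rewrite -natr1; field; rewrite natr1 pnatr_eq0.
Qed.

(** An invertible affine substitution with positive coefficients puts into [V] a polynomial in which
    [b] has a positive coefficient; that monomial can then be extracted. *)
Lemma monomial_downward (R : realType) (n : nat) (V : set ('cV[R]_n -> R^o)) (a b : multinom n) :
    linear_subspace V -> affine_invariant V ->
  V (monomial a) -> (mdeg b <= mdeg a)%N -> V (monomial b).
Proof.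
move=> linV affV Va ba.
pose q i : mpoly n R := mpolyX R (mnm1 i) + \sum_j mpolyX R (mnm1 j) + 1.
have [_ /(_ ba) pos] : 0 <= mcoeff b (\prod_i q i ^+ a i) /\
    ((mdeg b <= mdeg a)%N -> 0 < mcoeff b (\prod_i q i ^+ a i)).
  by apply: full_support_monomial => i; exact: full_support_affine.
apply: (monomial_of_coeff linV affV _ (lt0r_neq0 pos)).
have /(affV _ _ Va) : @Aff R n (fun x => (1%:M + const_mx 1) *m x + const_mx 1).
  by exists (1%:M + const_mx 1), (const_mx 1); rewrite unitmx_add_const1.
congr (V _); apply/funext => x; rewrite /monomial /= rmorph_prod; apply: eq_bigr => i _.
rewrite rmorphXn /= !mevalD meval1 mevalXU raddf_sum mulmxDl mul1mx !mxE; congr ((_ + _ + _) ^+ _).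
by apply: eq_bigr => j _; rewrite !mxE mul1r /= mevalXU.
Qed.

(** * The spaces of polynomial functions of bounded degree *)

Section PolynomialFunctions.
Context {R : realType} {n : nat}.
Implicit Types (l : nat) (f g : 'cV[R]_n -> R^o).

Lemma polyfun_le_leq l k f : (l <= k)%N -> polyfun_le R n l f -> polyfun_le R n k f.
Proof. by move=> lk [p [pl ->]]; exists p; split=> //; exact: leq_trans pl _. Qed.

Lemma polyfun_leZD l a f g : polyfun_le R n l f -> polyfun_le R n l g -> polyfun_le R n l (a *: f + g).
Proof.
move=> [p [pl ->]] [q [ql ->]]; exists (a *: p + q); split; last first.
  by apply/funext => x; rewrite mevalD mevalZ.
by rewrite (leq_trans (msizeD_le _ _)) // geq_max ql (leq_trans (msizeZ_le _ _)).
Qed.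

Lemma polyfun_leM l k f g : polyfun_le R n l f -> polyfun_le R n k g ->
  polyfun_le R n (l + k) (fun x => f x * g x : R).
Proof.
move=> [p [pl ->]] [q [qk ->]]; exists (p * q); split; last first.
  by apply/funext => x; rewrite mevalM.
(* Since [msize 0 = 0], the formula [(msize p + msize q).-1] for a product fails when a factor is
   zero. *)
have [->|p0] := eqVneq p 0; first by rewrite mul0r msize0.
have [->|q0] := eqVneq q 0; first by rewrite mulr0 msize0.
by rewrite msizeM // -subn1 leq_subLR add1n -addnS -addSn leq_add.
Qed.

Lemma polyfun_le_continuous l f : polyfun_le R n l f -> continuous f.
Proof.
have cm (m : multinom n) : continuous (monomial m : 'cV[R]_n -> R^o).
  move=> x; apply: (@cvg_big R _ _ _ _ (@mul_continuous R) _ (nbhs x)) => i _.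
  apply: (@continuous_comp _ _ _ (fun y : 'cV[R]_n => y i 0) (fun t => t ^+ m i)).
    exact: coord_continuous.
  exact: exprn_continuous.
move=> [p [_ ->]]; rewrite meval_monomials.
elim: (msupp p) => [|m s IH] x; first by rewrite big_nil; exact: (@cst_continuous _ _ (0 : R^o)).
rewrite big_cons; apply: continuousD; last exact: IH.
exact: (@cvgZl_tmp _ _ _ (nbhs x) _ _ _ _ (cm m x)).
Qed.

Lemma polyfun_le_linear_subspace l : linear_subspace (polyfun_le R n l).
Proof.
split=> [f|]; first exact: polyfun_le_continuous.
split=> [|a f g]; rewrite !inE; last exact: polyfun_leZD.
by exists 0; rewrite msize0; split=> //; apply/funext => x; rewrite meval0.
Qed.

Lemma monomial_polyfun_le (m : multinom n) : polyfun_le R n (mdeg m) (monomial m).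
Proof.
by exists (mpolyX R m); rewrite msizeX; split=> //; apply/funext => x; rewrite mevalX.
Qed.

Lemma polyfun_le_finite_dimensional l : finite_dimensional (polyfun_le R n l).
Proof.
(* Exponents of degree strictly below [l.+1], that is, at most [l]. *)
pose B : finType := bmultinom n l.+1.
exists #|B|, (fun i => monomial (enum_val i : B)); split=> [i|f [p [pl ->]]].
  by apply: polyfun_le_leq (monomial_polyfun_le _); rewrite -ltnS bmdeg.
exists (fun i => mcoeff (enum_val i : B) p); apply/funext => x.
rewrite fct_sumE {1}(mpolywE pl) raddf_sum (big_enum_val _ (A := B)) /=.
by apply: eq_bigr => i _; rewrite mevalZ mevalX.
Qed.

(** Each coordinate of [A *m x + b] has degree at most 1, so a monomial of degree [d] is sent to a
    product of degree at most [d]. *)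
Lemma polyfun_le_affine_invariant l : affine_invariant (polyfun_le R n l).
Proof.
move=> f g [p [pl ->]] [A [b [_ ->]]].
rewrite meval_monomials.
have linP := polyfun_le_linear_subspace.
have coord i : polyfun_le R n 1 (fun x => (A *m x + b) i 0).
  exists (\sum_j A i j *: mpolyX R (mnm1 j) + mpolyC n (b i 0)); split.
    rewrite (leq_trans (msizeD_le _ _)) // geq_max msizeC; case: eqP => //= _; rewrite ?andbT;
    rewrite (leq_trans (msize_sum _ _ _)) //; apply/bigmax_leqP => j _;
    by rewrite (leq_trans (msizeZ_le _ _)) // msizeX mdeg1.
  apply/funext => x; rewrite mevalD mevalC raddf_sum !mxE; congr (_ + _).
  by apply: eq_bigr => j _; rewrite /= mevalZ mevalXU.
have cst1 : polyfun_le R n 0 (fun=> 1).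
  by exists 1; rewrite msize1; split=> //; apply/funext => x; rewrite meval1.
have coordX i k : polyfun_le R n k (fun x => (A *m x + b) i 0 ^+ k).
  elim: k => [|k IH]; first exact: cst1.
  by under eq_fun do rewrite exprS; rewrite -add1n; exact: polyfun_leM.
have mono m : polyfun_le R n (mdeg m) (fun x => monomial m (A *m x + b)).
  rewrite mdegE; suff partial s : polyfun_le R n (\sum_(i <- s) m i)
      (fun x => \prod_(i <- s) (A *m x + b) i 0 ^+ m i : R) by exact: partial.
  elim: s => [|i s IH].
    by rewrite big_nil; under eq_fun do rewrite big_nil; exact: cst1.
  by rewrite big_cons; under [X in polyfun_le _ _ _ X]eq_fun do rewrite big_cons; exact: polyfun_leM.
rewrite (_ : _ \o _ = \sum_(m <- msupp p) mcoeff m p *: (fun x => monomial m (A *m x + b) : R^o)); last first.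
  by apply/funext => x; rewrite /= !fct_sumE.
rewrite big_seq; elim/big_ind : _ => [|f1 f2 F1 F2|m mp].
- exact: subspace0.
- by rewrite -[f1]scale1r; exact: polyfun_leZD.
rewrite -[_ *: _]addr0; apply: polyfun_leZD; last exact: subspace0.
apply: polyfun_le_leq (mono m).
by rewrite -ltnS (leq_trans (msize_mdeg_lt mp)).
Qed.

End PolynomialFunctions.

(** * Classification of the invariant subspaces and its converse *)

Theorem theorem2p2 (R : realType) (n : nat) (hn : (1 <= n)%N) :
  (forall V : set ('cV[R]_n -> R^o),
     linear_subspace V -> finite_dimensional V -> affine_invariant V ->
     V = [set 0] \/ exists l : nat, V = polyfun_le R n l) /\
  [/\ linear_subspace ([set 0] : set ('cV[R]_n -> R^o)),
      finite_dimensional ([set 0] : set ('cV[R]_n -> R^o)) &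
      affine_invariant ([set 0] : set ('cV[R]_n -> R^o))] /\
  (forall l : nat,
     [/\ linear_subspace (polyfun_le R n l),
         finite_dimensional (polyfun_le R n l) &
         affine_invariant (polyfun_le R n l)]).
Proof.
split; [|split].
- move=> V linV finV affV.
  pose bounded L := `[< forall f, V f ->
    exists p : mpoly n R, (msize p <= L)%N /\ f = (fun x => meval (fun i => x i 0) p) >].
  have exL : exists L, bounded L.
    by have [L VL] := finite_dim_polyfun linV finV affV; exists L; exact/asboolP.
  (* The least bound on [msize] decides the alternative: [0] leaves only the zero polynomial, and
     [l.+1] means degree at most [l]. *)
  case: (ex_minnP exL) => -[|l] /asboolP Vl minl.
    left; apply/seteqP; split=> [f /Vl[p []]|_ ->]; last exact: subspace0.
    rewrite leqn0 msize_poly_eq0 => /eqP -> ->.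
    by apply/funext => x; rewrite meval0.
  right; exists l; apply/seteqP; split=> [f /Vl //|f [p [pl ->]]].
  (* Otherwise all monomials occurring in elements of [V], being themselves in [V], would have
     degree below [l], and [l] would already be a bound. *)
  have [a [al Va]] : exists a : multinom n, (l <= mdeg a)%N /\ V (monomial a).
    apply: contrapT => noa; suff /minl : bounded l by rewrite ltnn.
    apply/asboolP => g Vg; have [q [ql gE]] := Vl g Vg; exists q; split=> //.
    rewrite msizeE; apply/bigmax_leqP_seq => m mq _.
    rewrite ltnNge; apply/negP => lm; apply: noa; exists m; split=> //.
    by apply: (monomial_of_coeff linV affV (p := q)); rewrite -?gE -?mcoeff_msupp.
  (* Every monomial of [p] has degree at most [l <= mdeg a], hence lies in [V]. *)
  rewrite meval_monomials big_seq; elim/big_ind : _ => [|f1 f2 V1 V2|m mp].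
  + exact: subspace0.
  + by rewrite -[f1]scale1r; exact: subspaceZD.
  rewrite -[_ *: _]addr0; apply: subspaceZD => //; last exact: subspace0.
  apply: (monomial_downward linV affV Va); apply: leq_trans al.
  by rewrite -ltnS (leq_trans (msize_mdeg_lt mp)).
- split.
  + split=> [f ->|]; first exact: (@cst_continuous _ _ (0 : R^o)).
    by split=> [|a f g]; rewrite !inE //= => -> ->; rewrite scaler0 addr0.
  + exists 0%N, (fun=> 0); split=> [[]//|f ->]; exists (fun=> 0).
    by rewrite big_ord0.
  + by move=> f g -> _; apply/funext.
- move=> l; split; [exact: polyfun_le_linear_subspace| |].
    exact: polyfun_le_finite_dimensional.
  exact: polyfun_le_affine_invariant.
Qed.
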